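(* Let $F$ be a field of characteristic $p>0$ and let $G$ be a finite group. Then the Reynolds ideal $R(FG)$ is an ideal in $FG$ if and only if $G' \subseteq O_p(G)$.
   Context: $FG$ is the group algebra of $G$ over $F$ and ''ideal'' of $FG$ means two-sided ideal. For a finite-dimensional $F$-algebra $A$, $\operatorname{soc}(A)$ is the (left) socle of $A$, i.e. the sum of all minimal left ideals, $Z(A)$ is the center of $A$, and the Reynolds ideal is $R(A) := \operatorname{soc}(A)\cap Z(A)$ (it is an ideal of $Z(A)$, but not necessarily of $A$). $G'$ is the derived subgroup and $O_p(G)$ the $p$-core (largest normal $p$-subgroup) of $G$. *)

(* Defs.v *)
From HB Require Import structures.
From mathcomp Require Import all_boot all_order all_fingroup all_algebra.
From mathcomp Require Import all_solvable all_field.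
Set Implicit Arguments. Unset Strict Implicit. Unset Printing Implicit Defensive.
Import GRing.Theory.
Local Open Scope ring_scope.

(* The element \sum_g a_g g of FG is encoded as the coefficient function
   g |-> a_g. The alias is needed because {ffun gT -> F^o} itself already
   carries the pointwise product; F^o provides the F-vector space structure. *)
Definition group_algebra (F : fieldType) (gT : finGroupType) : Type :=
  {ffun gT -> F^o}.

HB.instance Definition _ (F : fieldType) (gT : finGroupType) :=
  Vector.copy (group_algebra F gT) {ffun gT -> F^o}.

Section GroupAlgebraRing.
Variables (F : fieldType) (gT : finGroupType).
Local Notation FG := (group_algebra F gT).
Implicit Types x y z : FG.

Definition ga_elt (g : gT) : FG := [ffun h => (h == g)%:R].

Definition ga_one : FG := ga_elt 1%g.

Definition ga_mul x y : FG := [ffun g => \sum_(h : gT) x h * y (h^-1 * g)%g].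

Fact ga_mulA : associative ga_mul.
Proof.
move=> x y z; apply/ffunP=> g; rewrite !ffunE.
under [RHS]eq_bigr => k _ do rewrite ffunE big_distrl /=.
rewrite exchange_big /=; apply: eq_bigr => h _.
rewrite ffunE big_distrr /= [RHS](reindex_inj (mulgI h)) /=.
by apply: eq_bigr => k _; rewrite mulKg invMg mulgA mulrA.
Qed.

Fact ga_mul1l : left_id ga_one ga_mul.
Proof.
move=> x; apply/ffunP=> g; rewrite ffunE (bigD1 1%g) //= big1.
  by rewrite ffunE eqxx mul1r invg1 mul1g addr0.
by move=> h /negPf h1; rewrite ffunE h1 mul0r.
Qed.

Fact ga_mul1r : right_id ga_one ga_mul.
Proof.
move=> x; apply/ffunP=> g; rewrite ffunE (bigD1 g) //= big1.
  by rewrite ffunE mulVg eqxx mulr1 addr0.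
move=> h hg; rewrite ffunE -(inj_eq (mulgI h)) mulKVg mulg1 eq_sym.
by rewrite (negPf hg) mulr0.
Qed.

Fact ga_mulDl : left_distributive ga_mul +%R.
Proof.
move=> x y z; apply/ffunP=> g; rewrite !ffunE -big_split /=.
by apply: eq_bigr => h _; rewrite ffunE mulrDl.
Qed.

Fact ga_mulDr : right_distributive ga_mul +%R.
Proof.
move=> x y z; apply/ffunP=> g; rewrite !ffunE -big_split /=.
by apply: eq_bigr => h _; rewrite ffunE mulrDr.
Qed.

Fact ga_oner_neq0 : ga_one != 0.
Proof. by apply/eqP=> /ffunP/(_ 1%g)/eqP; rewrite !ffunE eqxx oner_eq0. Qed.

HB.instance Definition _ := GRing.Zmodule_isNzRing.Build FG
  ga_mulA ga_mul1l ga_mul1r ga_mulDl ga_mulDr ga_oner_neq0.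

Fact ga_scalerAl (a : F) x y : a *: (x * y) = (a *: x) * y.
Proof.
apply/ffunP=> g; rewrite !ffunE scaler_sumr.
by apply: eq_bigr => h _; rewrite ffunE scalerAl.
Qed.

HB.instance Definition _ := GRing.Lmodule_isLalgebra.Build F FG ga_scalerAl.

Fact ga_scalerAr (a : F) x y : a *: (x * y) = x * (a *: y).
Proof.
apply/ffunP=> g; rewrite !ffunE scaler_sumr.
by apply: eq_bigr => h _; rewrite ffunE scalerAr.
Qed.

HB.instance Definition _ := GRing.Lalgebra_isAlgebra.Build F FG ga_scalerAr.
HB.instance Definition _ := Algebra_isFalgebra.Build F FG.

Lemma ga_eltM g h : ga_elt (g * h)%g = ga_elt g * ga_elt h.
Proof.
apply/ffunP=> k; rewrite !ffunE (bigD1 g) //= big1 ?addr0.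
  by rewrite !ffunE eqxx mul1r -(inj_eq (mulgI g) (g^-1 * k)%g) mulKVg.
by move=> l /negPf lg; rewrite ffunE lg mul0r.
Qed.

Lemma ga_sumE x : x = \sum_g x g *: ga_elt g.
Proof.
apply/ffunP=> k; rewrite sum_ffunE (bigD1 k) //= big1 ?addr0.
  by rewrite !ffunE eqxx; apply/esym/mulr1.
move=> g gk; rewrite !ffunE eq_sym (negPf gk); exact: mulr0.
Qed.

End GroupAlgebraRing.

Section Reynolds.
Variables (F : fieldType) (A : falgType F).

(* A is unital, so its left ideals are automatically F-subspaces. *)
Definition left_ideal (U : {vspace A}) : Prop := ({:A} * U <= U)%VS.

Definition minimal_left_ideal (U : {vspace A}) : Prop :=
  [/\ left_ideal U, U != 0%VS &
      forall V : {vspace A},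
        left_ideal V -> (V <= U)%VS -> V != 0%VS -> V = U].

(* Membership in the sum of all minimal left ideals. There may be infinitely
   many of them, but every element of their sum lies in a finite subsum. *)
Definition in_socle (x : A) : Prop :=
  exists2 Us : seq {vspace A},
    forall U, U \in Us -> minimal_left_ideal U & x \in (\sum_(U <- Us) U)%VS.

Definition in_reynolds (x : A) : Prop := in_socle x /\ x \in 'Z({:A})%VS.

Definition two_sided_ideal (I : A -> Prop) : Prop :=
  [/\ I 0, forall x y, I x -> I y -> I (x - y) &
      forall a x, I x -> I (a * x) /\ I (x * a)].

End Reynolds.

Arguments in_reynolds {F} A x.

(* Main.v *)
Require Import Defs.
From mathcomp Require Import all_boot all_order all_fingroup all_algebra.
From mathcomp Require Import all_solvable all_field.
From Stdlib Require Import Classical.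

(** A central element [x] of an ideal lying in the centre satisfies
    [x (ab - ba) = 0], since [x a] is central too. So if the Reynolds ideal
    [R(FG)] is an ideal, right multiplication by every element of [G'] fixes
    every [x] in [R(FG)]. Apply this to the sum [s] of all [p]-elements of [G]:
    if [s c = s] then [c], like [1], lies in the support of [s] and is a
    [p]-element. Hence [G'] is a normal [p]-group ([der_pgroup]).

    The point is that [s] does belong to [R(FG)] ([p_elements_reynolds]). It is
    central, and for membership in the socle one uses the symmetrizing form
    [<x, y> = (x y)(1)], for which a subspace is its own double orthogonal
    ([ga_biorthogonal]). An element orthogonal to all minimal left ideals is
    nilpotent ([orthogonal_socle_nilpotent]), and pairing [s] with [x] gives
    the sum [phi(x)] of the coefficients of [x] at [p]-elements. So [phi] must
    vanish on nilpotent elements, which follows from the identity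
    [phi(x^p) = phi(x)^p] ([p_elt_sum_pow_p]): expand [x^p] as a sum over
    [p]-tuples of group elements, rotate the tuples cyclically, and observe
    that in characteristic [p] only the constant tuples contribute.

    Conversely, [O_p(G)] acts trivially on each minimal left ideal, because
    its fixed vectors form a nonzero submodule ([pgroup_fixed_vector],
    [pcore_trivial_on_minimal]); hence it acts trivially on the socle. If [G']
    lies in [O_p(G)], then [g h x = h g x] for [x] in the socle, and this makes
    [a x] central for every [x] in [R(FG)] ([der_pcore_reynolds_ideal]). *)

Set Implicit Arguments. Unset Strict Implicit. Unset Printing Implicit Defensive.
Import GRing.Theory.
Local Open Scope ring_scope.

(** * Minimal left ideals and the socle *)

Section Socle.
Variables (F : fieldType) (A : falgType F).
Implicit Types (U V S : {vspace A}) (x y a : A).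

Lemma ltn_dimv U V : (U <= V)%VS -> (\dim U < \dim V)%N = (U != V).
Proof. by move=> sUV; rewrite ltn_neqAle dimvS // andbT dimv_leqif_eq. Qed.

Lemma left_idealP U :
  left_ideal U <-> (forall a x, x \in U -> a * x \in U).
Proof.
split=> [/prodvP UU a x Ux | UU]; first exact: UU (memvf a) Ux.
by apply/prodvP=> a x _; apply: UU.
Qed.

Lemma exists_minimal_left_ideal U :
  left_ideal U -> U != 0%VS ->
  exists2 M, minimal_left_ideal M & (M <= U)%VS.
Proof.
have [n] := ubnP (\dim U); elim: n U => // n IHn U leUn idU nzU.
have [[V [idV sVU nzV neVU]] | noV] := classic (exists V,
    [/\ left_ideal V, (V <= U)%VS, V != 0%VS & V <> U]); last first.
  exists U; [split=> // V idV sVU nzV | exact: subvv].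
  by apply: NNPP => neVU; apply: noV; exists V.
have ltVU: (\dim V < \dim U)%N.
  by rewrite ltn_dimv //; apply/eqP.
have [M minM sMV] := IHn V (leq_trans ltVU leUn) idV nzV.
by exists M => //; apply: subv_trans sVU.
Qed.

Lemma sum_left_ideals (Us : seq {vspace A}) :
  (forall U, U \in Us -> left_ideal U) -> left_ideal (\sum_(U <- Us) U)%VS.
Proof.
move=> idUs; rewrite /left_ideal big_seq.
elim/big_rec: _ => [|U V UsU idV]; first by rewrite prodv0.
by rewrite prodvDr addvS //; apply: idUs.
Qed.

(** Although there may be infinitely many minimal left ideals, a finite sum of
    largest dimension absorbs all of them. This turns the socle into a
    subspace to which linear algebra applies. *)
Lemma exists_socle : exists2 Us : seq {vspace A},
  forall U, U \in Us -> minimal_left_ideal U &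
  forall M, minimal_left_ideal M -> (M <= \sum_(U <- Us) U)%VS.
Proof.
suff: forall n (Us : seq {vspace A}),
    (forall U, U \in Us -> minimal_left_ideal U) ->
    (\dim {:A} - \dim (\sum_(U <- Us) U) < n)%N ->
    exists2 Us : seq {vspace A}, forall U, U \in Us -> minimal_left_ideal U &
      forall M, minimal_left_ideal M -> (M <= \sum_(U <- Us) U)%VS.
  by move/(_ _ [::]) => socle; apply: (socle _ _ (leqnn _)).
elim=> // n IHn Us minUs leUs.
have [maxUs | ] := classic (forall M, minimal_left_ideal M ->
    (M <= \sum_(U <- Us) U)%VS); first by exists Us.
case/not_all_ex_not=> M nimp; have [minM /negP nsM] := imply_to_and _ _ nimp.
apply: (IHn (M :: Us)); first by move=> U /predU1P[-> | /minUs].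
rewrite big_cons; set S := (\sum_(U <- Us) U)%VS in leUs nsM *.
have ltS: (\dim S < \dim (M + S))%N.
  by rewrite ltn_dimv ?addvSr //; apply: contraNneq nsM => ->; apply: addvSl.
have leA: (\dim (M + S) <= \dim {:A})%N by rewrite dimvS ?subvf.
apply: leq_trans (leUs : (_ <= n)%N).
by apply: ltn_sub2l => //; apply: leq_trans ltS leA.
Qed.

Lemma in_socle_left_ideal a x : in_socle x -> in_socle (a * x).
Proof.
case=> Us minUs Sx; exists Us => //.
by apply: (left_idealP _).1 Sx; apply: sum_left_ideals => U /minUs[].
Qed.

Lemma in_reynoldsP x :
  in_reynolds A x <-> in_socle x /\ (forall a, x * a = a * x).
Proof.
rewrite /in_reynolds memv_cap memvf /=.
split=> -[sx cx]; split=> //.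
  by move=> a; apply: (centvP cx); apply: memvf.
by apply/centvP=> a _.
Qed.

Lemma in_socleB x y : in_socle x -> in_socle y -> in_socle (x - y).
Proof.
case=> [Us minUs Sx] [Vs minVs Sy]; exists (Us ++ Vs) => [U | ].
  by rewrite mem_cat => /orP[/minUs | /minVs].
by rewrite big_cat memv_add ?memvN.
Qed.

Lemma chain_stabilizes (V : nat -> {vspace A}) :
  (forall n, V n.+1 <= V n)%VS -> exists n, V n.+1 = V n.
Proof.
move=> decV; apply: NNPP => neV.
have ltV n : (\dim (V n.+1) < \dim (V n))%N.
  by rewrite ltn_dimv //; apply/eqP=> eqV; apply: neV; exists n.
have bound n : (\dim (V n) + n <= \dim (V 0%N))%N.
  elim: n => [|n IHn]; first by rewrite addn0.
  by rewrite addnS -addSn (leq_trans _ IHn) ?leq_add2r.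
have := bound (\dim (V 0%N)).+1.
by rewrite addnS ltnNge leq_addl.
Qed.

Lemma left_annihilator_contains_minimal a x : x != 0 -> x * a = 0 ->
  exists2 M, minimal_left_ideal M & forall y, y \in M -> y * a = 0.
Proof.
move=> nzx xa0; have kerP y : (y \in lker (amulr a)) = (y * a == 0).
  by rewrite memv_ker lfunE.
have [||M minM sM] := @exists_minimal_left_ideal (lker (amulr a)).
- by apply/left_idealP=> b y; rewrite !kerP -mulrA => /eqP->; rewrite mulr0.
- by apply: contraNneq nzx => ker0; rewrite -memv0 -ker0 kerP xa0.
by exists M => // y /(subvP sM); rewrite kerP => /eqP.
Qed.
End Socle.

(** * Sums invariant under a p-group *)

Section InvariantSum.
Variables (R : nzRingType) (p : nat) (charRp : p \in [pchar R]).
Variables (aT : finGroupType) (X : finType) (to : {action aT &-> X}).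
Variables (G : {group aT}) (w : X -> R).

(** An orbit that is not a fixed point has cardinality divisible by [p], so it
    contributes a multiple of [p] to the sum. *)
Lemma sum_pgroup_fix : (p.-group G)%g ->
    (forall b x, b \in G -> w (to x b) = w x) ->
  \sum_x w x = \sum_(x in 'Fix_to(G)%g) w x.
Proof.
move=> pG w_inv.
rewrite (bigID [in 'Fix_to(G)%g]) /= [X in _ + X = _](_ : _ = 0) ?addr0 //.
have actsG: [acts G, on ~: 'Fix_to(G)%g | to].
  by rewrite astabsC; apply: acts_fix_norm; apply: normG.
have /and3P[/eqP covP tiP _] := orbit_partition actsG.
rewrite (eq_bigl [in ~: 'Fix_to(G)%g]) => [|x]; last by rewrite in_setC.
rewrite -covP big_trivIset //= big1 // => _ /imsetP[x nfx ->].
rewrite (eq_bigr (fun=> w x)) => [|_ /orbitP[a Ga <-]]; last exact: w_inv.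
rewrite sumr_const.
have [k oGx]: {k | #|orbit to G x| = (p ^ k)%N}.
  by apply: p_natP; apply: pnat_dvd (dvdn_orbit _ _ _) pG.
rewrite oGx; case: k oGx => [/card_orbit1 fix_x | k _].
  by move: nfx; rewrite in_setC => /orbit1P[].
by rewrite expnS mulrnA (mulrn_pchar charRp) mul0rn.
Qed.
End InvariantSum.

(** * Cyclic rotation of tuples of group elements *)

Section CyclicShift.
Variables (gT : finGroupType) (p : nat).

Definition cyclic_shift (f : {ffun 'Z_p -> gT}) (k : 'Z_p) :=
  [ffun i : 'Z_p => f (i + k)].

Fact cyclic_shift1 : cyclic_shift^~ 1%g =1 id.
Proof. by move=> f; apply/ffunP=> i; rewrite ffunE addr0. Qed.

Fact cyclic_shiftM f : act_morph cyclic_shift f.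
Proof.
move=> k l; apply/ffunP=> i; rewrite !ffunE -addrA.
by congr (f (_ + _)); apply: addrC.
Qed.

(** The group acting is the additive group of [Z/p]. *)
Canonical cyclic_shift_action := TotalAction cyclic_shift1 cyclic_shiftM.

(** The shifted product is a conjugate of the original one, so both are
    [p]-elements or neither is. *)
Lemma prod_shift n (f : 'Z_n -> gT) :
  (\prod_i f (i + 1)%R = (\prod_i f i) ^ f 0%R)%g.
Proof.
rewrite big_ord_recr [in RHS]big_ord_recl /= conjgE -mulgA mulKg.
congr (_ * f _)%g; last first.
  by apply/val_inj; rewrite /= (@modn_small 1) // addn1 modnn.
apply: eq_bigr => i _; congr (f _); apply/val_inj.
by rewrite /= (@modn_small 1) // addn1 modn_small // ltnS.
Qed.

Lemma p_eltXp (g : gT) : prime p -> (p.-elt (g ^+ p) = p.-elt g)%g.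
Proof.
move=> p_pr; have co : coprime (#[g]%g`_p^') p.
  by rewrite coprime_sym (@pnat_coprime p) ?pnat_id ?part_pnat.
by rewrite -[in RHS](expg1 g) !p_elt_exp -(Gauss_dvdr 1 co) muln1.
Qed.
End CyclicShift.

(** * The symmetrizing form of the group algebra *)

Section GroupAlgebra.
Variables (F : fieldType) (gT : finGroupType).
Local Notation FG := (group_algebra F gT).
Local Notation e := (@ga_elt F gT).
Implicit Types (x y a : FG) (g h : gT).

Lemma ga_mulE x y g : (x * y) g = \sum_h x h * y (h^-1 * g)%g.
Proof. by rewrite ffunE. Qed.

Lemma ga_mul_eltl h x g : (e h * x) g = x (h^-1 * g)%g.
Proof.
rewrite ga_mulE (bigD1 h) //= ffunE eqxx mul1r big1 ?addr0 // => k /negPf nkh.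
by rewrite ffunE nkh mul0r.
Qed.

Lemma ga_mul_eltr h x g : (x * e h) g = x (g * h^-1)%g.
Proof.
rewrite ga_mulE (bigD1 (g * h^-1)%g) //= ffunE invMg invgK mulgKV eqxx mulr1.
rewrite big1 ?addr0 // => k nk; rewrite ffunE.
case: eqP => [kg | _]; last by rewrite mulr0.
by case/eqP: nk; rewrite -kg invMg invgK mulKVg.
Qed.

Lemma ga_trace_form_sym x y : (x * y) 1%g = (y * x) 1%g.
Proof.
rewrite !ga_mulE (reindex_inj invg_inj) /=; apply: eq_bigr => h _.
by rewrite invgK !mulg1 mulrC.
Qed.

(** Every functional is represented by the form. Coordinates of endomorphisms
    are the functionals that projections provide. *)
Lemma ga_functional (f : 'End(FG)) g :
  exists a, forall x, (x * a) 1%g = f x g.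
Proof.
exists [ffun h => f (e h^-1) g] => x.
rewrite ga_mulE [in RHS](ga_sumE x) linear_sum sum_ffunE; apply: eq_bigr => h _.
by rewrite ffunE mulg1 invgK linearZ ffunE.
Qed.

Lemma ga_nondegenerate x : (forall a, (a * x) 1%g = 0) -> x = 0.
Proof.
move=> x0; apply/ffunP=> g; rewrite [RHS]ffunE -(x0 (e g^-1)) ga_mul_eltl.
by rewrite invgK mulg1.
Qed.

(** If [x] were outside [S], some coordinate of its component in a complement
    of [S] would be a functional vanishing on [S] but not at [x]. *)
Lemma ga_biorthogonal (S : {vspace FG}) x :
  (forall a, (forall y, y \in S -> (y * a) 1%g = 0) -> (x * a) 1%g = 0) ->
  x \in S.
Proof.
move=> perp; have [->|] := eqVneq x (projv S x); first exact: memv_proj.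
rewrite -subr_eq0 => nzx.
suff: x - projv S x = 0 by move/eqP; rewrite (negPf nzx).
apply/ffunP=> g; rewrite [RHS]ffunE.
have [a aE] := ga_functional (\1 - projv S)%VF g.
have aE' y : (y * a) 1%g = (y - projv S y) g.
  by rewrite aE add_lfunE opp_lfunE id_lfunE.
by rewrite -aE'; apply: perp => y Sy; rewrite aE' projv_id // subrr ffunE.
Qed.

(** First, [1 - ab] is left regular for every [b]: otherwise its left
    annihilator contains a minimal left ideal [M], on which [y = yab], so that
    [<c, y> = <bcy, a> = 0] for all [c] and [M = 0]. Next, the chain of right
    ideals [a^n FG] stabilizes, giving [a^n (1 - ab) = 0] for some [n] and [b],
    hence [a^n = 0]. *)
Lemma orthogonal_socle_nilpotent a :
  (forall M : {vspace FG}, minimal_left_ideal M ->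
     forall y, y \in M -> (y * a) 1%g = 0) ->
  exists n, a ^+ n = 0.
Proof.
move=> perp.
have regular b x : x * (1 - a * b) = 0 -> x = 0.
  move=> xab; apply/eqP/negP=> /negP nzx.
  have [M minM Mann] := left_annihilator_contains_minimal nzx xab.
  have [idM nzM _] := minM.
  case/negP: nzM; rewrite -subv0; apply/subvP=> y My.
  rewrite memv0; apply/eqP/ga_nondegenerate=> c.
  have -> : y = y * a * b.
    by apply/eqP; rewrite -subr_eq0 -{1}(mulr1 y) -mulrA -mulrBr Mann.
  rewrite mulrA ga_trace_form_sym !mulrA.
  by apply: (perp M) => //; apply: (left_idealP M).1.
have [|n eqV] := @chain_stabilizes F FG (fun n => limg (amull (a ^+ n))).
  move=> n; apply/subvP=> _ /memv_imgP[c _ ->].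
  rewrite lfunE /= exprSr -mulrA; apply/memv_imgP.
  by exists (a * c); rewrite ?memvf ?lfunE.
have: a ^+ n \in limg (amull (a ^+ n.+1)).
  by rewrite eqV; apply/memv_imgP; exists 1; rewrite ?memvf // lfunE /= mulr1.
case/memv_imgP=> b _; rewrite lfunE /= exprSr => eqn; exists n.
by apply: (regular b); rewrite mulrBr mulr1 mulrA -eqn subrr.
Qed.

Lemma ga_eltX g n : e (g ^+ n) = e g ^+ n.
Proof. by elim: n => // n IHn; rewrite expgS exprS ga_eltM IHn. Qed.

Lemma ga_elt_prod n (f : 'I_n -> gT) : e (\prod_i f i)%g = \prod_i e (f i).
Proof. exact: (big_morph e (@ga_eltM F gT) (erefl 1)). Qed.

Lemma ga_commute_ext x :
  (forall g, x * e g = e g * x) -> forall a, x * a = a * x.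
Proof.
move=> cx a; rewrite (ga_sumE a) mulr_sumr mulr_suml; apply: eq_bigr => g _.
by rewrite -scalerAl -scalerAr cx.
Qed.

(** * The sum of the coefficients at p-elements *)

Variable p : nat.
Hypothesis charFp : p \in [pchar F].

Definition p_elt_sum x : F := \sum_(g | (p.-elt g)%g) x g.

Lemma p_elt_sum_elt g : p_elt_sum (e g) = (p.-elt g)%g%:R.
Proof.
rewrite /p_elt_sum big_mkcond (bigD1 g) //= ffunE eqxx big1 ?addr0.
  by case: ifP.
by move=> h /negPf nhg; rewrite ffunE nhg if_same.
Qed.

Lemma p_elt_sum_lin (I : finType) (c : I -> F) (x : I -> FG) :
  p_elt_sum (\sum_i c i *: x i) = \sum_i c i * p_elt_sum (x i).
Proof.
rewrite /p_elt_sum; under eq_bigr => g _ do rewrite sum_ffunE.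
rewrite exchange_big /=; apply: eq_bigr => i _.
by rewrite mulr_sumr; apply: eq_bigr => g _; rewrite ffunE.
Qed.

(** The summand [w f] attached to a tuple [f] is invariant under rotation, and
    the tuples fixed by rotation are the constant ones, with product [g^p]. *)
Lemma p_elt_sum_pow_p x : p_elt_sum (x ^+ p) = p_elt_sum x ^+ p.
Proof.
have p_pr := pcharf_prime charFp.
have Dp : (Zp_trunc p).+2 = p by apply: Zp_cast; apply: prime_gt1.
pose w (f : {ffun 'Z_p -> gT}) :=
  (\prod_i x (f i)) * (p.-elt (\prod_i f i))%g%:R.
have -> : p_elt_sum (x ^+ p) = \sum_f w f.
  rewrite -{1}Dp -[in x ^+ _](card_ord (Zp_trunc p).+2) -prodr_const.
  rewrite [X in \prod_(i in _) X](ga_sumE x) bigA_distr_bigA /=.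
  under eq_bigr => f _ do rewrite scaler_prod -ga_elt_prod.
  by rewrite p_elt_sum_lin; apply: eq_bigr => f _; rewrite p_elt_sum_elt.
have w_shift1 f : w (cyclic_shift f 1%R) = w f.
  rewrite /w; congr (_ * _).
    rewrite [RHS](reindex_inj (addIr (1 : 'Z_p))) /=.
    by apply: eq_bigr => i _; rewrite ffunE.
  under [in LHS]eq_bigr => i _ do rewrite ffunE.
  by rewrite prod_shift p_eltJ.
have w_shift (k : 'Z_p) f : k \in [set: 'Z_p] -> w (cyclic_shift f k) = w f.
  move=> _; rewrite -[k]natr_Zp; elim: (val k) f => [|n IHn] f.
    by rewrite cyclic_shift1.
  by rewrite mulrS (cyclic_shiftM f) IHn w_shift1.
rewrite (@sum_pgroup_fix _ _ charFp _ _ (cyclic_shift_action gT p)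
           [set: 'Z_p]%G w) //; last first.
  by rewrite /pgroup cardsT card_ord Dp pnat_id.
have fixE : [set f | f \in 'Fix_(cyclic_shift_action gT p)([set: 'Z_p])%g] =
   [set [ffun=> g] | g : gT].
  apply/setP=> f; rewrite inE; apply/afixP/imsetP=> [fixf | [g _ ->] k _].
    exists (f 0) => //; apply/ffunP=> i; rewrite ffunE -{2}(fixf i) ?inE //=.
    by rewrite ffunE add0r.
  by apply/ffunP=> i; rewrite !ffunE.
rewrite -(eq_bigl _ _ (fun f => in_set _ f)) fixE big_imset /=; last first.
  by move=> g h _ _ /ffunP/(_ 0); rewrite !ffunE.
rewrite -(pFrobenius_autE charFp) rmorph_sum /= [RHS]big_mkcond /=.
apply: eq_bigr => g _; rewrite /w.
under eq_bigr => i _ do rewrite ffunE.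
have -> : (\prod_(i < (Zp_trunc p).+2) [ffun=> g] i = g ^+ p)%g.
  under eq_bigr => i _ do rewrite ffunE.
  by rewrite prodg_const card_ord Dp.
rewrite prodr_const card_ord Dp pFrobenius_autE.
rewrite p_eltXp //.
by case: ifP => _; rewrite ?mulr1 ?mulr0.
Qed.

Lemma p_elt_sum_nilpotent x n : x ^+ n = 0 -> p_elt_sum x = 0.
Proof.
move=> xn0.
have pow k : p_elt_sum (x ^+ (p ^ k)) = p_elt_sum x ^+ (p ^ k).
  by elim: k => // k IHk; rewrite expnSr !exprM p_elt_sum_pow_p IHk.
have p_gt1 : (1 < p)%N by apply: prime_gt1 (pcharf_prime charFp).
have ltn : (n <= p ^ n)%N by apply/ltnW/ltn_expl.
have sum0 : p_elt_sum 0 = 0 by rewrite /p_elt_sum big1 // => g _; rewrite ffunE.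
have := pow n; rewrite -{1}(subnK ltn) exprD xn0 mulr0 sum0 => /esym/eqP.
by rewrite expf_eq0 => /andP[_ /eqP].
Qed.

(** * The sum of all p-elements lies in the Reynolds ideal *)

Definition p_elements : FG := [ffun g => (p.-elt g)%g%:R].

Lemma p_elements_trace x : (p_elements * x) 1%g = p_elt_sum x.
Proof.
rewrite ga_mulE (reindex_inj invg_inj) /p_elt_sum [RHS]big_mkcond /=.
apply: eq_bigr => g _; rewrite ffunE p_eltV invgK mulg1.
by case: ifP; rewrite ?mul1r ?mul0r.
Qed.

Lemma p_elements_reynolds : in_reynolds FG p_elements.
Proof.
apply/in_reynoldsP; split; last first.
  apply: ga_commute_ext => g; apply/ffunP=> h.
  rewrite ga_mul_eltr ga_mul_eltl !ffunE -(p_eltJ p _ g) conjgE.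
  by rewrite mulgKV.
have [Us minUs maxUs] := exists_socle FG; exists Us => //.
apply: ga_biorthogonal => a perp; rewrite p_elements_trace.
have [M minM y My | n an0] := @orthogonal_socle_nilpotent a.
  by apply: perp; apply: (subvP (maxUs M minM)).
exact: p_elt_sum_nilpotent an0.
Qed.

(** As [x g] is again central, [x g k = x k g] for all [k]: group elements may
    be permuted to the right of [x]. *)
Lemma reynolds_ideal_fixes_commutators x g h :
  two_sided_ideal (in_reynolds FG) -> in_reynolds FG x ->
  x * e [~ g, h]%g = x.
Proof.
case=> _ _ idR Rx.
have [_ cx] := (in_reynoldsP x).1 Rx.
have comm k l : x * e (k * l)%g = x * e (l * k)%g.
  have [_ cxk] := (in_reynoldsP _).1 (idR (e k) x Rx).2.
  by rewrite !ga_eltM !mulrA cxk mulrA cx.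
have -> : [~ g, h]%g = ((g^-1 * h^-1) * (g * h))%g.
  by rewrite commgEl conjgE !mulgA.
by rewrite ga_eltM mulrA comm -mulrA -ga_eltM -invMg mulVg mulr1.
Qed.

(** The coefficients of [s c = s] at [c] show that [c] is a [p]-element, as [1]
    is; and the solutions [c] of this equation form a subgroup. *)
Lemma der_pgroup :
  two_sided_ideal (in_reynolds FG) -> (p.-group [set: gT]^`(1))%g.
Proof.
move=> idR.
pose H := [set c | p_elements * e c == p_elements].
have gH : group_set H.
  apply/group_setP; split=> [|c d]; rewrite !inE ?mulr1 // => /eqP cH /eqP dH.
  by rewrite ga_eltM mulrA cH dH.
have sG'H : ([set: gT]^`(1) \subset Group gH)%g.
  rewrite derg1 gen_subG; apply/subsetP=> _ /imset2P[g h _ _ ->].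
  by rewrite inE (reynolds_ideal_fixes_commutators _ _ idR p_elements_reynolds).
apply/pgroupP=> q q_pr /(Cauchy q_pr)[c /(subsetP sG'H) + oc].
rewrite inE => /eqP/ffunP/(_ c); rewrite ga_mul_eltr !ffunE mulgV p_elt1.
case pc: (p.-elt c)%g => /eqP; last by rewrite oner_eq0.
by move: pc; rewrite /p_elt oc pnatE.
Qed.

(** * The p-core acts trivially on the socle *)

Lemma ga_elt_sub1_nilpotent g : (p.-elt g)%g -> exists n, (e g - 1) ^+ n = 0.
Proof.
case/p_natP=> k og; exists (p ^ k)%N.
have charA : p \in [pchar FG] by rewrite pchar_lalg.
suff: forall m, (e g - 1) ^+ (p ^ m) = e (g ^+ (p ^ m))%g - 1.
  by move->; rewrite -og expg_order subrr.
elim=> // m IHm; rewrite expnSr exprM IHm -(pFrobenius_autE charA).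
rewrite pFrobenius_autB_comm; last exact: commr1.
by rewrite !pFrobenius_autE expr1n -ga_eltX -expgM.
Qed.

(** Take a nonzero [x] in [U] with stabilizer as large as possible. If the
    stabilizer [S] is proper, its normalizer in [P] contains some [g] outside
    [S]. All the vectors [y i = (g - 1)^i x] are still fixed by [S], and since
    [g - 1] is nilpotent the last nonzero one is also fixed by [g], against
    the maximality. *)
Lemma pgroup_fixed_vector (P : {group gT}) (U : {vspace FG}) :
  (p.-group P)%g -> left_ideal U -> U != 0%VS ->
  exists2 x, x \in U & x != 0 /\ forall g, g \in P -> e g * x = x.
Proof.
move=> pP /left_idealP idU nzU.
pose stab x := [set g in P | e g * x == x].
suff: forall n x, x \in U -> x != 0 -> (#|P| - #|stab x| < n)%N ->
    exists2 x, x \in U & x != 0 /\ forall g, g \in P -> e g * x = x.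
  move=> fixU; apply: (fixU _ (vpick U)) (leqnn _); first exact: memv_pick.
  by rewrite vpick0.
elim=> // n IHn x Ux nzx leSn.
have sSP : stab x \subset P by apply/subsetP=> g; rewrite inE => /andP[].
have gS : group_set (stab x).
  apply/group_setP; split=> [|g h]; rewrite !inE ?group1 ?mul1r //=.
  case/andP=> Pg /eqP gx /andP[Ph /eqP hx].
  by rewrite groupM // ga_eltM -mulrA hx gx /=.
have [sPS | ] := boolP (P \subset stab x).
  by exists x => //; split=> // g /(subsetP sPS); rewrite inE => /andP[_ /eqP].
move=> nsPS.
have pSP : Group gS \proper P by rewrite properE sSP.
have := nilpotent_proper_norm (pgroup_nil pP) pSP.
case/properP=> _ [g /setIP[Pg Ng] nSg].
have [m gm0] := ga_elt_sub1_nilpotent (mem_p_elt pP Pg).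
pose y i := (e g - 1) ^+ i * x.
have /ex_minnP[i yi0 mini] : exists i, y i == 0.
  by exists m; rewrite /y gm0 mul0r.
case: i => [|i] in yi0 mini; first by rewrite /y mul1r (negPf nzx) in yi0.
have nzyi : y i != 0 by apply/negP=> /mini; rewrite ltnn.
have gyi : e g * y i = y i.
  by apply/eqP; rewrite -subr_eq0 -{2}(mul1r (y i)) -mulrBl mulrA -exprS.
have Sy j h : h \in stab x -> e h * y j = y j.
  elim: j h => [|j IHj] h Sh.
    by move: Sh; rewrite inE /y mul1r => /andP[_ /eqP].
  have ShG : (h ^ g)%g \in stab x by have := memJ_norm h Ng; rewrite /= Sh.
  rewrite /y exprS -mulrA -/(y j) mulrA mulrBr mulr1 -ga_eltM conjgC ga_eltM.
  by rewrite !mulrBl -mulrA (IHj _ ShG) (IHj _ Sh) mul1r.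
apply: (IHn (y i)) => //; first exact: idU.
apply: leq_trans (leSn : (_ <= n)%N); apply: ltn_sub2l.
  exact: proper_card.
apply/proper_card/properP; split.
  by apply/subsetP=> h Sh; rewrite inE (subsetP sSP) //= Sy.
by exists g => //; rewrite inE Pg gyi /=.
Qed.

(** By minimality [U = FG y] for a nonzero vector [y] fixed by the [p]-core,
    and normality lets [g] pass through the coefficient [b] of [b y]. *)
Lemma pcore_trivial_on_minimal (U : {vspace FG}) (g : gT) x :
  minimal_left_ideal U -> (g \in 'O_p([set: gT]))%g -> x \in U -> e g * x = x.
Proof.
case=> idU nzU minU Pg.
have [y Uy [nzy fixy]] :=
  pgroup_fixed_vector (pcore_pgroup p [set: gT]) idU nzU.
have defU : limg (amulr y) = U.
  apply: minU.
  - apply/left_idealP=> a _ /memv_imgP[b _ ->].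
    by apply/memv_imgP; exists (a * b); rewrite ?memvf // !lfunE /= mulrA.
  - apply/subvP=> _ /memv_imgP[b _ ->]; rewrite lfunE /=.
    exact: (left_idealP U).1.
  apply: contraNneq nzy => im0; rewrite -memv0 -im0; apply/memv_imgP.
  by exists 1; rewrite ?memvf // lfunE /= mul1r.
rewrite -{1}defU => /memv_imgP[b _ ->]; rewrite lfunE /=.
rewrite (ga_sumE b) mulr_suml mulr_sumr; apply: eq_bigr => h _.
rewrite -!scalerAl -scalerAr; congr (_ *: _).
rewrite mulrA -ga_eltM conjgC ga_eltM -mulrA fixy //.
by rewrite memJ_norm // (subsetP (normal_norm (pcore_normal _ _))) ?inE.
Qed.

Lemma pcore_trivial_on_socle g x :
  (g \in 'O_p([set: gT]))%g -> in_socle x -> e g * x = x.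
Proof.
move=> Pg [Us minUs]; rewrite big_seq => Sx.
suff: x \in lker (amull (e g) - \1)%VF.
  by rewrite memv_ker add_lfunE opp_lfunE id_lfunE lfunE subr_eq0 => /eqP.
move: x Sx; apply/subvP; elim/big_rec: _ => [|U V /minUs minU sV].
  exact: sub0v.
rewrite subv_add sV andbT; apply/subvP=> x Ux.
rewrite memv_ker add_lfunE opp_lfunE id_lfunE lfunE /=.
by rewrite (pcore_trivial_on_minimal minU) ?subrr.
Qed.

Lemma der_pcore_reynolds_ideal :
  ([set: gT]^`(1) \subset 'O_p([set: gT]))%g ->
  two_sided_ideal (in_reynolds FG).
Proof.
move=> sG'P.
split=> [|x y /in_reynoldsP[sx cx] /in_reynoldsP[sy cy]
         |a x /in_reynoldsP[sx cx]].
- apply/in_reynoldsP; split; last by move=> a; rewrite mulr0 mul0r.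
  by exists [::] => //; apply: mem0v.
- apply/in_reynoldsP; split; first exact: in_socleB.
  by move=> a; rewrite mulrBl mulrBr cx cy.
rewrite cx; suff Rax : in_reynolds FG (a * x) by [].
apply/in_reynoldsP; split; first exact: in_socle_left_ideal.
have comm g h : e g * (e h * x) = e h * (e g * x).
  rewrite !mulrA -!ga_eltM commgC (@ga_eltM F gT (h * g)) -mulrA.
  rewrite (@pcore_trivial_on_socle [~ g, h]%g _ _ sx) //.
  by apply: (subsetP sG'P); rewrite derg1 mem_commg ?inE.
apply: ga_commute_ext => g; rewrite -mulrA cx (ga_sumE a).
rewrite !mulr_suml mulr_sumr; apply: eq_bigr => h _.
by rewrite -!scalerAl -scalerAr comm.
Qed.

End GroupAlgebra.

(** * The criterion *)

Theorem theorem1 (F : fieldType) (p : nat) (charFp : p \in [pchar F]%R)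
    (gT : finGroupType) :
  two_sided_ideal (in_reynolds (group_algebra F gT)) <->
  ([set: gT]^`(1) \subset 'O_p([set: gT]))%g.
Proof.
split=> [idR | ]; last exact: der_pcore_reynolds_ideal charFp.
apply: pcore_max (der_normal _ _); exact: der_pgroup charFp idR.
Qed.
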